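(* For all integers $n\ge0$ and $\alpha\ge1$: \[ \overline{p}_{9}(36n+33)\equiv0 \pmod{3}, \] \[ \overline{p}_{9}\bigl(3^{2\alpha}(3n+j)\bigr)\equiv0 \pmod{3}\quad\text{for } j=1,2, \] \[ \overline{p}_{9}(3n)\equiv\overline{p}_{9}\bigl(3^{2\alpha}(3n)\bigr) \pmod{3}. \]
   Context: For $k\ge1$ let $f_k=\prod_{m\ge1}(1-q^{km})$. $\overline{p}_9(n)$ denotes the number of 2-color overpartitions of $n$ (the first occurrence of a part of each color may be overlined) in which one of the two colors appears only in parts that are multiples of $9$; its generating function is $\sum_{n\ge0}\overline{p}_9(n)q^n=\dfrac{f_2f_{18}}{f_1^2f_9^2}$. *)

(* Defs.v *)
From mathcomp Require Import all_boot.

Set Implicit Arguments.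
Unset Strict Implicit.
Unset Printing Implicit Defensive.

(* A coloured part of a partition of n is a pair (k, c) where k <= n is the
   size of the part and c its colour; the colour [true] is the one that is
   restricted to multiples of l.  The type also contains the size 0, which
   [is_2col_overpart] forbids. *)
Definition cpart (n : nat) : finType := ('I_n.+1 * bool)%type.

(* A 2-colour overpartition of n is encoded by the multiplicity of each
   coloured part (at most n) together with the set of the coloured parts whose
   first occurrence is overlined. *)
Definition is_2col_overpart (l n : nat)
    (w : {ffun cpart n -> 'I_n.+1} * {set cpart n}) : bool :=
  let: (mult, over) := w in
  [&& [forall x : cpart n, (0 < mult x) ==> (0 < x.1)],
      [forall x : cpart n, (0 < mult x) && x.2 ==> (l %| x.1)],
      [forall x in over, 0 < mult x]
    & \sum_(x : cpart n) mult x * x.1 == n].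

Definition pbar (l n : nat) : nat :=
  #|[set w : {ffun cpart n -> 'I_n.+1} * {set cpart n} |
      is_2col_overpart l w]|.

(* Main.v *)
(* Write theta(q) = 1 + 2 sum_(s >= 1) (-1)^s q^(s^2).  By Gauss' identity
   f_1^2 / f_2 = theta(q), the generating function G of pbar 9 satisfies
   G theta(q) theta(q^9) = 1.  Over F_3 one has theta(q)^3 = theta(q^3), so that
   G theta(q^3) theta(q^9) = theta(q)^2.  Squares are 0 or 1 modulo 3, and those
   divisible by 3 are divisible by 9, so extracting the exponents divisible by 3
   turns the right-hand side into theta(q^3)^2; cancelling leaves
   sum_m pbar 9 (3m) q^m = theta(q)^2 over F_3.  Up to sign, pbar 9 (3m) is thus
   the number of representations of m as a sum of two squares, which vanishes for
   m = 3 mod 4 and for m exactly divisible by an odd power of 3, and is unchanged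
   when m is multiplied by 9.
   Power series are replaced by polynomials modulo a power of 'X. *)
Require Import Defs.
From mathcomp Require Import all_boot all_algebra all_field.
From mathcomp Require Import ring zify.

Set Implicit Arguments.
Unset Strict Implicit.
Unset Printing Implicit Defensive.

Import GRing.Theory.
Local Open Scope ring_scope.

(** * Gauss' identity in finite form *)

Definition theta (R : comNzRingType) (n : nat) (q : R) : R :=
  1 + 2 * \sum_(1 <= s < n.+1) (-1) ^+ s * q ^+ (s ^ 2).

Definition qpoch (R : comNzRingType) (m n : nat) (q : R) : R :=
  \prod_(m <= k < n) (1 - q ^+ k).

Lemma thetaS (R : comNzRingType) (n : nat) (q : R) :
  theta n.+1 q = theta n q + 2 * (-1) ^+ n.+1 * q ^+ (n.+1 ^ 2).
Proof. by rewrite /theta big_nat_recr //=; ring. Qed.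

Lemma theta0 (R : comNzRingType) (q : R) : theta 0 q = 1.
Proof. by rewrite /theta big_geq // mulr0 addr0. Qed.

(* Shanks' finite form of Gauss' identity, with denominators cleared: the last
   sum is divisible by q^(n+1).  The induction on n telescopes over s. *)
Lemma theta_qpoch (R : comNzRingType) (n : nat) (q : R) :
  (\prod_(1 <= k < n.+1) (1 + q ^+ k)) * theta n q =
  qpoch 1 n.+1 q +
  \sum_(1 <= s < n.+1) 2 * (-1) ^+ s * (\prod_(1 <= k < s) (1 + q ^+ k)) *
                       qpoch s.+1 n.+1 q * q ^+ (s * n.+1).
Proof.
elim: n => [|n IHn]; first by rewrite theta0 /qpoch !big_geq // mulr1 addr0.
pose Q s := \prod_(1 <= k < s) (1 + q ^+ k).
(* Telescoping certificate: when [n] grows by one, the [s]-th error term, once the common factor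
   [1 + q^(n+1)] is accounted for, changes by [h s - h s.+1]. *)
pose h s : R := 2 * (-1) ^+ s.-1 * Q s * qpoch s n.+1 q * q ^+ (s * n.+1).
have QS s : (0 < s)%N -> Q s.+1 = Q s * (1 + q ^+ s).
  by move=> s0; rewrite /Q big_nat_recr.
rewrite thetaS mulrDr -/(Q _) QS // mulrAC IHn mulrDl.
rewrite [in RHS]big_nat_recr //= -/(Q _).
pose F m s : R := 2 * (-1) ^+ s * Q s * qpoch s.+1 m.+1 q * q ^+ (s * m.+1).
have step s : (0 < s < n.+1)%N ->
    F n.+1 s - F n s * (1 + q ^+ n.+1) = - (h s.+1 - h s).
  case/andP=> s0 sn; rewrite /F /h QS // {1}/qpoch big_nat_recr //= -/(qpoch _ _ _).
  rewrite [qpoch s n.+1 q]/qpoch big_ltn // -/(qpoch _ _ _).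
  have -> : (s * n.+2 = s * n.+1 + s)%N by lia.
  have -> : (s.+1 * n.+1 = s * n.+1 + n.+1)%N by lia.
  have -> : (-1) ^+ s = - (-1) ^+ s.-1 :> R by rewrite -{1}(prednK s0) exprS mulN1r.
  by rewrite !exprD; ring.
have tele : \sum_(1 <= s < n.+1) F n.+1 s =
    (\sum_(1 <= s < n.+1) F n s) * (1 + q ^+ n.+1) - (h n.+1 - h 1%N).
  rewrite -(telescope_sumr h (ltn0Sn n)) -sumrN -(eq_big_nat _ _ step) sumrB -mulr_suml.
  by rewrite addrC subrK.
have qpochnn m : qpoch m m q = 1 by rewrite /qpoch big_geq.
have -> : qpoch 1 n.+2 q = qpoch 1 n.+1 q * (1 - q ^+ n.+1).
  by rewrite /qpoch big_nat_recr.
(* The boundary value [h 1] absorbs the replacement of [1 + q^(n+1)] by [1 - q^(n+1)] in the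
   product; [h n.+1] and the new error term [F n.+1 n.+1] together match the new term of theta. *)
rewrite -[\sum_(1 <= i < n.+1) _ in RHS]/(\sum_(1 <= i < n.+1) F n.+1 i) tele.
rewrite /h /= !qpochnn mul1n.
have -> : Q 1%N = 1 by rewrite /Q big_geq.
have -> : (n.+1 ^ 2 = n.+1 * n.+1)%N by [].
have -> : (n.+1 * n.+2 = n.+1 * n.+1 + n.+1)%N by lia.
by rewrite exprD [(-1) ^+ n.+1]exprS expr0 -/(F n); ring.
Qed.

(** * Congruence of polynomials modulo a power of ['X] *)

Definition congX (F : fieldType) (n : nat) (p q : {poly F}) : bool :=
  'X^n %| p - q.

Section CongX.
Variable F : fieldType.
Implicit Types (n m : nat) (p q r : {poly F}).

Lemma congX_refl n p : congX n p p.
Proof. by rewrite /congX subrr dvdp0. Qed.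

Lemma congX_sym n p q : congX n p q = congX n q p.
Proof. by rewrite /congX -opprB dvdpNr. Qed.

Lemma congX_trans n q p r : congX n p q -> congX n q r -> congX n p r.
Proof. by move=> pq qr; rewrite /congX -(subrKA q) dvdp_add. Qed.

Lemma congX_mul n p p' q q' :
  congX n p p' -> congX n q q' -> congX n (p * q) (p' * q').
Proof.
move=> pp' qq'; rewrite /congX.
have -> : p * q - p' * q' = (p - p') * q + p' * (q - q') by ring.
by apply: dvdp_add; [apply: dvdp_mulr | apply: dvdp_mull].
Qed.

Lemma congX_leq m n p q : (m <= n)%N -> congX n p q -> congX m p q.
Proof. by move=> mn; apply: dvdp_trans (dvdp_exp2l _ mn). Qed.

(** Stands in for inverting a power series: a nonzero constant term makes [r] coprime to ['X^n]. *)
Lemma congX_mulIr n r p q : r`_0 != 0 -> congX n (p * r) (q * r) -> congX n p q.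
Proof.
move=> r0; rewrite /congX -mulrBl Gauss_dvdpl //.
by apply: coprimep_expl; rewrite coprimep_sym coprimepX rootE horner_coef0.
Qed.

Lemma congXP n p q :
  reflect (forall i, (i < n)%N -> p`_i = q`_i) (congX n p q).
Proof.
apply: (iffP idP) => [/dvdpP[r pq] i ilt | eqpq].
  by apply/eqP; rewrite -subr_eq0 -coefB pq coefMXn ilt.
apply/dvdpP; exists (drop_poly n (p - q)).
rewrite -[LHS](poly_take_drop n) -[RHS]add0r; congr (_ + _).
apply/polyP => i; rewrite coef_take_poly coef0; case: ifP => // lt_in.
by rewrite coefB eqpq // subrr.
Qed.

End CongX.

(** * Truncated theta series modulo powers of ['X] *)

Lemma rmorph_theta (R S : comNzRingType) (f : {rmorphism R -> S}) n q :
  f (theta n q) = theta n (f q).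
Proof.
rewrite /theta rmorphD rmorph1 rmorphM rmorph_nat rmorph_sum.
by under eq_bigr => s _ do rewrite rmorphM rmorph_sign rmorphXn.
Qed.

Lemma theta_Xd_coef0 (F : fieldType) d n : (0 < d)%N ->
  (theta n ('X^d : {poly F}))`_0 = 1.
Proof.
move=> d0; elim: n => [|n IHn]; first by rewrite theta0 coef1.
by rewrite thetaS coefD IHn -exprM coefMXn muln_gt0 d0 expn_gt0 addr0.
Qed.

(** The extra terms have exponents at least [d * n.+1 ^ 2]; the weaker modulus is the one that the
    finite Gauss identity provides. *)
Lemma congX_thetaD (F : fieldType) d n m :
  congX (d * n.+1) (theta (n + m) ('X^d : {poly F})) (theta n 'X^d).
Proof.
elim: m => [|m IHm]; first by rewrite addn0 congX_refl.
rewrite addnS thetaS; apply: congX_trans IHm.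
rewrite /congX addrAC subrr add0r dvdp_mull // -exprM dvdp_exp2l //.
by rewrite leq_mul2l; apply/orP; right; nia.
Qed.

(** The product of all [1 + q^k] is f_2 / f_1, so this is a truncation of theta = f_1^2 / f_2 with
    denominators cleared. *)
Lemma congX_theta_qpoch (F : fieldType) d n :
  congX (d * n.+1)
    ((\prod_(1 <= k < n.+1) (1 + 'X^d ^+ k)) * theta n ('X^d : {poly F}))
    (qpoch 1 n.+1 'X^d).
Proof.
rewrite theta_qpoch /congX addrAC subrr add0r.
rewrite big_nat; elim/big_ind: _ => [|p q|s /andP[s0 _]].
- exact: dvdp0.
- exact: dvdp_add.
by rewrite dvdp_mull // -exprM dvdp_exp2l // leq_mul2l leq_pmull ?orbT.
Qed.

(** * Extraction of the exponents divisible by [d], and Frobenius *)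

Definition section_poly (R : nzRingType) (d : nat) (p : {poly R}) : {poly R} :=
  \poly_(i < size p) p`_(d * i).

Lemma coef_section_poly (R : nzRingType) d (p : {poly R}) i : (0 < d)%N ->
  (section_poly d p)`_i = p`_(d * i).
Proof.
move=> d0; rewrite coef_poly; case: ltnP => // le_p_i.
by rewrite nth_default // (leq_trans le_p_i) // leq_pmull.
Qed.

(** Extraction is linear over the polynomials in ['X^d]; this is what lets theta(q^3) theta(q^9) be
    pulled out of it. *)
Lemma section_polyMcomp (R : comNzRingType) d (p r : {poly R}) : (0 < d)%N ->
  section_poly d (p * (r \Po 'X^d)) = section_poly d p * r.
Proof.
move=> d0; elim/poly_ind: r => [|r c IHr].
  apply/polyP=> i.
  by rewrite coef_section_poly // comp_poly0 !mulr0 !coef0.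
rewrite comp_poly_MXaddC mulrDr mulrA mulrDr mulrA -IHr.
apply/polyP=> i; rewrite coef_section_poly // !coefD !coefMC coefMX coefMXn.
rewrite !coef_section_poly //.
case: i => [|i]; first by rewrite muln0 d0.
by rewrite mulnS ltnNge leq_addr /= addKn.
Qed.

(** The bound says that [d * (n - 1)], the last index read when [n] is positive, lies below [m]. *)
Lemma congX_section_poly (F : fieldType) d n m (p q : {poly F}) : (0 < d)%N ->
  (d * n < m + d)%N -> congX m p q -> congX n (section_poly d p) (section_poly d q).
Proof.
move=> d0 dnm /congXP pq; apply/congXP => i ltin.
by rewrite !coef_section_poly // pq //; nia.
Qed.

(** Frobenius is additive in characteristic [p] and fixes the coefficients. *)
Lemma Fp_exprp_comp p (r : {poly 'F_p}) : prime p -> r ^+ p = r \Po 'X^p.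
Proof.
move=> p_pr; elim/poly_ind: r => [|r c IHr].
  by rewrite comp_poly0 expr0n; case: p p_pr.
rewrite comp_poly_MXaddC -IHr exprDn_pchar; last first.
  rewrite pnatE // pchar_poly pchar_Fp //.
by rewrite exprMn -polyC_exp -[X in c ^+ X](card_Fp p_pr) expf_card.
Qed.

(** * Dissections of theta and signed counts of sums of two squares *)

(** The terms [s = 3 * t] form theta(q^9), because [3 * t] and [t] have the same parity; all other
    squares are 1 modulo 3. *)
Lemma theta_dissect3 (R : comNzRingType) n : exists B : {poly R},
  theta (3 * n) 'X = theta n ('X^9) + 'X * (B \Po 'X^3).
Proof.
elim: n => [|n [B IHn]].
  by exists 0; rewrite muln0 !theta0 comp_poly0 mulr0 addr0.
(* The exponents come from the squares of [3 * n + 1] and [3 * n + 2], less 1 and divided by 3; the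
   two terms have opposite signs. *)
exists (B + 2 * (-1) ^+ (3 * n).+1 *
            ('X^(3 * n ^ 2 + 2 * n) - 'X^(3 * n ^ 2 + 4 * n + 1))).
rewrite mulnS !addSn add0n !thetaS IHn.
rewrite comp_polyD !comp_polyM comp_polyB !comp_Xn_poly !rmorphXn rmorphN rmorph1 rmorph_nat.
rewrite -!exprM.
have -> : ((3 * n).+1 ^ 2 = 1 + 3 * (3 * n ^ 2 + 2 * n))%N by lia.
have -> : ((3 * n).+2 ^ 2 = 1 + 3 * (3 * n ^ 2 + 4 * n + 1))%N by lia.
have -> : ((3 * n).+3 ^ 2 = 9 * n.+1 ^ 2)%N by lia.
have -> : (-1) ^+ (3 * n).+1 = (-1) ^+ n.+1 :> {poly R}.
  by rewrite -signr_odd -[in RHS]signr_odd; congr (_ ^+ _); lia.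
rewrite !exprD ![(-1) ^+ _.+1]exprS.
have -> : (-1) ^+ (3 * n) = (-1) ^+ n :> {poly R}.
  by rewrite -signr_odd -[in RHS]signr_odd; congr (_ ^+ _); lia.
ring.
Qed.

(** Even squares are 0 and odd squares 1 modulo 4. *)
Lemma theta_dissect4 (R : comNzRingType) n : exists A B : {poly R},
  theta (2 * n) 'X = (A \Po 'X^4) + 'X * (B \Po 'X^4).
Proof.
elim: n => [|n [A [B IHn]]].
  by exists 1, 0; rewrite muln0 theta0 comp_poly0 mulr0 addr0 comp_polyC.
exists (A + 2 * 'X^(n.+1 ^ 2)), (B - 2 * 'X^(n ^ 2 + n)).
rewrite mulnS !addSn add0n !thetaS IHn.
have sgn2n : (-1) ^+ (2 * n) = 1 :> {poly R} by rewrite exprM sqrrN !expr1n.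
rewrite ![(-1) ^+ _.+1]exprS sgn2n.
rewrite comp_polyD comp_polyB !comp_polyM !comp_Xn_poly rmorph_nat.
rewrite -!exprM.
have -> : ((2 * n).+1 ^ 2 = 1 + 4 * (n ^ 2 + n))%N by lia.
have -> : ((2 * n).+2 ^ 2 = 4 * (n.+1 ^ 2))%N by lia.
by rewrite !exprD; ring.
Qed.


(* This is (-1)^n r_2(n), since the terms of theta beyond n do not matter. *)
Definition r2signed (R : comNzRingType) (n : nat) : R :=
  (theta n ('X : {poly R}) ^+ 2)`_n.

Lemma r2signed_theta (F : fieldType) m n : (m <= n)%N ->
  ((theta n ('X : {poly F})) ^+ 2)`_m = r2signed F m.
Proof.
move=> lemn; have := @congX_thetaD F 1 m (n - m).
rewrite subnKC // mul1n expr1 => th.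
by have /congXP-> := congX_mul th th.
Qed.

(** In the square of the 3-dissection the cross term and the last square have exponents 1 and 2
    modulo 3, so only the square of theta(q^9) survives. *)
Lemma section_theta_sqr (R : comNzRingType) n :
  section_poly 3 (theta (3 * n) ('X : {poly R}) ^+ 2) = theta n 'X^3 ^+ 2.
Proof.
have [B ->] := theta_dissect3 R n.
have thE : theta n 'X^9 = theta n 'X^3 \Po 'X^3 :> {poly R}.
  by rewrite (rmorph_theta (comp_poly 'X^3)) /= comp_Xn_poly -exprM.
apply/polyP => i; rewrite coef_section_poly //.
have -> : (theta n 'X^9 + 'X * (B \Po 'X^3)) ^+ 2 =
    ((theta n 'X^3 ^+ 2) \Po 'X^3) + ((2 * theta n 'X^3 * B) \Po 'X^3) * 'X +
    (B ^+ 2 \Po 'X^3) * 'X^2 :> {poly R}.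
  rewrite thE ![in RHS]rmorphM rmorph_nat /=; ring.
rewrite !coefD coefMX coefMXn !coef_comp_poly_Xn // dvdn_mulr // mulKn //.
(* Index 0 is separate: the truncated subtractions below would give 0, which 3 divides, but there
   the shifted coefficients are 0 by definition. *)
case: i => [|i]; first by rewrite muln0 !addr0.
have -> : (3 %| (3 * i.+1).-1)%N = false by lia.
have -> : (3 %| (3 * i.+1 - 2))%N = false by lia.
by rewrite ?if_same !addr0.
Qed.

Lemma r2signed_mul3 (F : fieldType) n :
  r2signed F (3 * n) = if (3 %| n)%N then r2signed F (n %/ 3) else 0.
Proof.
rewrite /r2signed -coef_section_poly // section_theta_sqr.
have -> : theta n 'X^3 = theta n 'X \Po 'X^3 :> {poly F}.
  by rewrite (rmorph_theta (comp_poly 'X^3)) /= comp_polyX.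
rewrite -rmorphXn coef_comp_poly_Xn //; case: ifP => // _.
by rewrite r2signed_theta // leq_div.
Qed.

(** A sum of two squares is 0, 1 or 2 modulo 4. *)
Lemma r2signed_mod4 (F : fieldType) n : r2signed F (4 * n + 3) = 0.
Proof.
(* The cut-off is doubled because the 4-dissection is stated for even cut-offs. *)
rewrite -(@r2signed_theta _ _ (2 * (4 * n + 3))); last lia.
have [A [B ->]] := theta_dissect4 F (4 * n + 3).
have -> : ((A \Po 'X^4) + 'X * (B \Po 'X^4)) ^+ 2 =
    ((A ^+ 2) \Po 'X^4) + ((2 * A * B) \Po 'X^4) * 'X +
    ((B ^+ 2) \Po 'X^4) * 'X^2.
  rewrite ![in RHS]rmorphM rmorph_nat /=; ring.
rewrite !coefD coefMX coefMXn !coef_comp_poly_Xn //.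
have -> : (4 %| 4 * n + 3)%N = false by lia.
have -> : (4 %| (4 * n + 3).-1)%N = false by lia.
have -> : (4 %| 4 * n + 3 - 2)%N = false by lia.
by rewrite ?if_same !addr0.
Qed.

Lemma r2signed_9 (F : fieldType) n a : r2signed F (9 ^ a * n) = r2signed F n.
Proof.
elim: a => [|a IHa]; first by rewrite mul1n.
by rewrite expnS -mulnA -[9%N]/(3 * 3)%N -mulnA r2signed_mul3 dvdn_mulr // mulKn.
Qed.

(** * The generating function of [pbar] *)

Definition allowed (l k : nat) (c : bool) : bool :=
  (0 < k)%N && (c ==> (l %| k)%N).

(* The number of ways of overlining m copies of a part, or 0 if the part is
   forbidden and m > 0. *)
Definition part_weight (l k : nat) (c : bool) (m : nat) : nat :=
  if m is 0 then 1 else if allowed l k c then 2 else 0.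

(** For fixed multiplicities, the overlined parts form an arbitrary subset of the support: a factor
    2 for each part that occurs, and nothing at all if one of these is forbidden. *)
Lemma pbar_sum l n : pbar l n =
  (\sum_(f : {ffun cpart n -> 'I_n.+1})
     (\prod_(x : cpart n) part_weight l x.1 x.2 (f x)) *
     (\sum_(x : cpart n) f x * x.1 == n))%N.
Proof.
rewrite /pbar -sum1_card big_mkcond /=.
rewrite (eq_bigr (fun p => if (p.1, p.2) \in [set w | is_2col_overpart l w]
    then 1%N else 0%N)); last by case.
rewrite -(pair_bigA _ (fun f A =>
    if (f, A) \in [set w | is_2col_overpart l w] then 1%N else 0%N)) /=.
apply: eq_bigr => f _; pose supp := [set x | (0 < f x)%N].
pose good := [forall x, (x \in supp) ==> allowed l x.1 x.2].
have is2 A : is_2col_overpart l (f, A) =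
    [&& good, A \subset supp & (\sum_(x : cpart n) f x * x.1 == n)%N].
  rewrite /is_2col_overpart /= andbA; congr (_ && (_ && _)); last first.
    apply/forall_inP/subsetP => sA x xA; first by rewrite inE sA.
    by have := sA _ xA; rewrite inE.
  apply/andP/forallP => [[/forallP p0 /forallP pl] x | gd].
    have := p0 x; have := pl x; rewrite inE /allowed.
    by case: (0 < f x)%N => //= /implyP lx ->; apply/implyP.
  split; apply/forallP => x; have := gd x; rewrite inE /allowed;
    case: (0 < f x)%N => //=; case/andP=> // -> //.
under eq_bigr => A _ do rewrite inE is2.
rewrite -big_mkcond /=.
case: (boolP good) => [gd|]; last first.
  rewrite negb_forall => /existsP[x]; rewrite negb_imply inE => /andP[fx nx].
  rewrite big_pred0 // (bigD1 x) //= /part_weight (negbTE nx).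
  by case: (nat_of_ord (f x)) fx => //; rewrite mul0n mul0n.
case: eqP => _ /=; last first.
  by rewrite muln0 big_pred0 // => A; rewrite andbF.
rewrite muln1 (eq_bigl (mem (powerset supp))); last first.
  by move=> A; rewrite andbT [RHS]powersetE.
rewrite sum1_card card_powerset -prod_nat_const big_mkcond; apply: eq_bigr => x _.
have := forallP gd x; rewrite inE /part_weight.
by case: (nat_of_ord (f x)) => //= k ->.
Qed.

(** For an allowed part this is (1 + q^k) / (1 - q^k), cut off at multiplicity [N]. *)
Definition part_series (R : nzRingType) (N l k : nat) (c : bool) : {poly R} :=
  \sum_(m < N.+1) (part_weight l k c m)%:R *: 'X^(m * k).

Lemma pbar_coef (R : comNzRingType) l n :
  (pbar l n)%:R =
  (\prod_(x : cpart n) part_series R n l x.1 x.2)`_n.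
Proof.
rewrite pbar_sum natr_sum /part_series bigA_distr_bigA coef_sum.
apply: eq_bigr => f _.
by rewrite scaler_prod -natr_prod prodrXr coefZ coefXn natrM eq_sym.
Qed.

(** Geometric sum, from (1 + x) / (1 - x) = 2 / (1 - x) - 1; the cut-off causes the last term. *)
Lemma part_series_allowed (R : comNzRingType) N l k c :
  part_series R N l k c * (if allowed l k c then 1 - 'X^k else 1) =
  if allowed l k c then 1 + 'X^k - 2 * 'X^(k * N.+1) else 1.
Proof.
rewrite /part_series /part_weight; case: ifP => _; last first.
  by rewrite mulr1 big_ord_recl big1 => [|i _]; rewrite ?scale0r // scale1r addr0.
have -> : \sum_(m < N.+1) (if m : nat is 0 then 1 else 2)%:R *: 'X^(m * k)
    = 2 * (\sum_(m < N.+1) 'X^k ^+ m) - 1 :> {poly R}.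
  rewrite !big_ord_recl /= scale1r mul0n expr0 mulrDr mulr_sumr.
  rewrite addrAC; congr (_ + _); first by ring.
  by apply: eq_bigr => i _; rewrite -exprM mulnC scaler_nat mulr_natl.
have := subrX1 ('X^k : {poly R}) N.+1; rewrite -exprM => geom.
rewrite -['X^(k * N.+1)](subrK 1) geom; ring.
Qed.

Lemma prod_multiples (R : comNzRingType) l n (g : nat -> R) : (0 < l)%N ->
  \prod_(1 <= k < n.+1) (if (l %| k)%N then g k else 1) =
  \prod_(1 <= j < (n %/ l).+1) g (l * j)%N.
Proof.
move=> l0; elim: n => [|n IHn]; first by rewrite div0n !big_geq.
rewrite big_nat_recr //= IHn divnS //; case: ifP => [ln|_]; last by rewrite mulr1.
rewrite add1n [RHS]big_nat_recr //=; congr (_ * g _).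
by have := divnS n l0; rewrite ln add1n => <-; rewrite mulnC divnK.
Qed.

Lemma prod_cpart (R : comNzRingType) l n (g : nat -> R) : (0 < l)%N ->
  \prod_(x : cpart n) (if allowed l x.1 x.2 then g x.1 else 1) =
  (\prod_(1 <= k < n.+1) g k) * \prod_(1 <= j < (n %/ l).+1) g (l * j)%N.
Proof.
move=> l0; rewrite -prod_multiples //.
rewrite -(pair_bigA _ (fun k c =>
    if allowed l (k : 'I_n.+1) c then g k else 1)) /=.
rewrite -big_split big_nat.
rewrite -(big_mkord xpredT
    (fun k => \prod_c (if allowed l k c then g k else 1))) /=.
(* Size 0 is never allowed, so both of its factors are 1. *)
rewrite big_ltn // {1}big_bool /= mul1r mul1r big_nat.
apply: eq_bigr => k /andP[k0 _].
by rewrite big_bool /allowed k0 /= mulrC.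
Qed.

(** Let N and D be the products of the [1 + q^k] and of the [1 - q^k] over the allowed parts. Then G
    D = N, while Gauss' identity gives N theta(q) theta(q^l) = D; the claim follows on cancelling
    N. *)
Lemma pbar_theta (F : fieldType) l n : (0 < l)%N ->
  exists2 G : {poly F}, G`_n = (pbar l n)%:R &
    congX n.+1 (G * (theta n 'X * theta n 'X^l)) 1.
Proof.
move=> l0; exists (\prod_(x : cpart n) part_series F n l x.1 x.2).
  by rewrite pbar_coef.
set G := \prod_x _.
pose Q (a : F) d N : {poly F} := \prod_(1 <= k < N.+1) (1 + a *: 'X^d ^+ k).
have GD : congX n.+1 (G * (Q (-1) 1%N n * Q (-1) l (n %/ l)%N))
    (Q 1 1%N n * Q 1 l (n %/ l)%N).
  have QE a : Q a 1%N n * Q a l (n %/ l)%N =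
      \prod_(x : cpart n) (if allowed l x.1 x.2 then 1 + a *: 'X^(x.1) else 1).
    rewrite (prod_cpart _ (fun k => 1 + a *: 'X^k)) //; congr (_ * _).
    by apply: eq_bigr => k _; rewrite exprM.
  rewrite !QE -big_split /=; elim/big_ind2: _ => [|p p' q q'|x _].
  - exact: congX_refl.
  - exact: congX_mul.
  rewrite scaleN1r scale1r part_series_allowed.
  case: ifP => [/andP[x0 _]|_]; last exact: congX_refl.
  rewrite /congX addrAC subrr add0r dvdpNr dvdp_mull // dvdp_exp2l //.
  by rewrite leq_pmull.
have QD d N : Q (-1) d N = qpoch 1 N.+1 'X^d.
  by apply: eq_bigr => k _; rewrite scaleN1r.
have QN d N : Q 1 d N = \prod_(1 <= k < N.+1) (1 + 'X^d ^+ k).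
  by apply: eq_bigr => k _; rewrite scale1r.
have Q0 d N : (0 < d)%N -> (Q 1 d N)`_0 = 1.
  move=> d0; rewrite /Q big_nat; elim/big_ind: _ => [|p q p0 q0|k /andP[k0 _]].
  - by rewrite coef1.
  - by rewrite coef0M p0 q0 mul1r.
  by rewrite coefD scale1r -exprM coef1 coefXn eqxx ltn_eqF ?addr0 // muln_gt0 d0.
have th1 : congX n.+1 (Q 1 1%N n * theta n 'X) (Q (-1) 1%N n).
  by rewrite QN QD; have := congX_theta_qpoch F 1 n; rewrite mul1n expr1.
(* The multiples of [l] up to [n] stop at index [n %/ l], so Gauss' identity applies with that
   cut-off; this bound makes it hold modulo ['X^n.+1] and lets theta be extended to cut-off [n]. *)
have le_n : (n.+1 <= l * (n %/ l).+1)%N by rewrite mulnC ltn_ceil.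
have thl : congX n.+1 (Q 1 l (n %/ l)%N * theta n 'X^l) (Q (-1) l (n %/ l)%N).
  apply: congX_trans
    (congX_leq le_n (_ : congX _ (_ * theta (n %/ l) 'X^l) _)).
    apply: congX_mul; first exact: congX_refl.
    apply: congX_leq le_n _; have := congX_thetaD F l (n %/ l) (n - n %/ l).
    by rewrite subnKC // leq_div.
  by rewrite QN QD; apply: congX_theta_qpoch.
apply: (@congX_mulIr _ _ (Q 1 1%N n * Q 1 l (n %/ l)%N)).
  by rewrite coef0M !Q0 // mul1r oner_neq0.
rewrite mul1r; apply: congX_trans GD.
rewrite -mulrA mulrACA -[theta n 'X * _]mulrC -[theta n 'X^l * Q _ _ _]mulrC.
by rewrite !(congX_mul, congX_refl).
Qed.

(** * Reduction modulo 3 to sums of two squares *)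

Lemma pbar9_mul3 m : (pbar 9 (3 * m))%:R = r2signed 'F_3 m.
Proof.
have [G <- Gth] := pbar_theta 'F_3 (3 * m) (isT : 0 < 9)%N.
set t := theta (3 * m) ('X : {poly 'F_3}) in Gth.
have cube n : theta n 'X ^+ 3 = theta n 'X^3 :> {poly 'F_3}.
  by rewrite Fp_exprp_comp // (rmorph_theta (comp_poly 'X^3)) /= comp_polyX.
have t9 : theta (3 * m) 'X^9 = (t ^+ 3) \Po 'X^3 :> {poly 'F_3}.
  by rewrite cube (rmorph_theta (comp_poly 'X^3)) /= comp_Xn_poly -exprM.
(* Extraction lowers the cut-off from [3 * m] to [m]; this restores it. *)
have tt : congX m.+1 (theta m 'X^3 : {poly 'F_3}) (t ^+ 3).
  rewrite cube congX_sym; apply: (@congX_leq _ _ (3 * m.+1)); first lia.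
  by have := @congX_thetaD 'F_3 3 m (2 * m); rewrite -mulSn.
(* Multiplying by [t ^+ 2] completes [t] to a cube, so that the cofactor of [G] becomes a polynomial
   in ['X^3]. *)
have Gt2 : congX (3 * m).+1 (G * ((t * t ^+ 3) \Po 'X^3)) (t ^+ 2).
  rewrite rmorphM /= -t9 -Fp_exprp_comp //.
  have -> : G * (t ^+ 3 * theta (3 * m) 'X^9) =
      G * (t * theta (3 * m) 'X^9) * t ^+ 2 by ring.
  by rewrite -[X in congX _ _ X]mul1r congX_mul // congX_refl.
have t0 : t`_0 = 1 by apply: (@theta_Xd_coef0 'F_3 1).
have r0 : (t * t ^+ 3)`_0 != 0.
  by rewrite coef0M t0 cube theta_Xd_coef0 // mulr1 oner_neq0.
(* After extraction the right-hand side is theta(q^3)^2, that is [t ^+ 6], from which [t * t ^+ 3]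
   cancels to leave [t ^+ 2]. *)
have /(congX_mulIr r0)/congXP/(_ m (leqnn _)) :
    congX m.+1 (section_poly 3 G * (t * t ^+ 3)) (t ^+ 2 * (t * t ^+ 3)).
  rewrite -section_polyMcomp //.
  apply: congX_trans (congX_section_poly _ _ Gt2) _ => //; first lia.
  rewrite section_theta_sqr.
  have -> : t ^+ 2 * (t * t ^+ 3) = t ^+ 3 * t ^+ 3 by ring.
  exact: congX_mul.
by rewrite coef_section_poly // => ->; rewrite r2signed_theta // leq_pmull.
Qed.

Local Close Scope ring_scope.

Theorem theorem4p6 (n alpha : nat) (halpha : 1 <= alpha) :
  [/\ pbar 9 (36 * n + 33) = 0 %[mod 3],
      forall j : nat, j = 1 \/ j = 2 ->
        pbar 9 (3 ^ (2 * alpha) * (3 * n + j)) = 0 %[mod 3]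
    & pbar 9 (3 * n) = pbar 9 (3 ^ (2 * alpha) * (3 * n)) %[mod 3]].
Proof.
have modE a b : a%:R%R = b%:R%R :> 'F_3 -> a = b %[mod 3].
  by move/(congr1 val); rewrite /= !val_Fp_nat.
split.
- apply: modE; have -> : 36 * n + 33 = 3 * (4 * (3 * n + 2) + 3) by lia.
  by rewrite pbar9_mul3 r2signed_mod4.
- move=> j j12; apply: modE; case: alpha halpha => // a _.
  (* One factor 3 goes to [pbar9_mul3], which leaves an odd power of 3: once [9 ^ a] is removed, a
     single 3 remains, as 3 does not divide [3 * n + j]. *)
  have -> : 3 ^ (2 * a.+1) * (3 * n + j) = 3 * (9 ^ a * (3 * (3 * n + j))).
    by rewrite mulnS expnD expnM -[3 ^ 2]/9; ring.
  rewrite pbar9_mul3 r2signed_9 r2signed_mul3.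
  by case: ifP => //; case: j12 => ->; lia.
- apply: modE; have -> : 3 ^ (2 * alpha) * (3 * n) = 3 * (9 ^ alpha * n).
    by rewrite expnM mulnCA.
  by rewrite !pbar9_mul3 r2signed_9.
Qed.
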